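(* Given $(a_m)_{m=1}^M\subseteq(0,\infty)$ and $(\lambda_n)_{n=1}^N\subseteq(0,\infty)$, PNSTC can be used to construct a frame $(f_m)_{m=1}^M$ for $\mathbb R^N$ such that $\|f_m\|=a_m$ for $m=1,\ldots,M$ and having eigenvalues $(\lambda_n)_{n=1}^N$ if and only if there exist permutations that make the sequences $(a_m)_{m=1}^M$ and $(\lambda_n)_{n=1}^N$ Spectral Tetris ready.
   Context: Frames. For a finite sequence $(f_m)_{m=1}^M\subseteq\mathbb R^N$ let $F$ be the $N\times M$ matrix with columns $f_1,\dots,f_M$ (the synthesis matrix). The sequence is a frame for $\mathbb R^N$ if its frame operator $S=FF^*$ satisfies $AI\le S\le BI$ for some positive constants $A,B$. The eigenvalues of the frame are the eigenvalues of $S$, counted with multiplicity. Spectral Tetris ready. Two sequences $(a_m)_{m=1}^M$ and $(\lambda_n)_{n=1}^N$ (in a given order) are Spectral Tetris ready if $\sum_{m=1}^M a_m^2=\sum_{n=1}^N\lambda_n$ and if there is a partition $0\le m_1<\cdots<m_N=M$ of the set $\{0,1,\ldots,M\}$ (that is, integers $m_1,\ldots,m_N$ forming such a strictly increasing chain) such that for all $k=1,\ldots,N-1$: (i) $\sum_{m=1}^{m_k}a_m^2\le\sum_{n=1}^k\lambda_n<\sum_{m=1}^{m_k+1}a_m^2$; and (ii) if $\sum_{m=1}^{m_k}a_m^2<\sum_{n=1}^k\lambda_n$, then $m_{k+1}-m_k\ge 2$ and $a_{m_k+2}^2\ge\sum_{n=1}^k\lambda_n-\sum_{m=1}^{m_k}a_m^2$.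 The PNSTC (Prescribed Norms Spectral Tetris Construction) algorithm. Parameters: the dimension $N\in\mathbb N$, the number of frame elements $M\in\mathbb N$, and eigenvalues $(\lambda_n)_{n=1}^N$ and norms $(a_m)_{m=1}^M$ which are Spectral Tetris ready (the given sequences may be permuted to achieve this). Let $(e_n)_{n=1}^N$ be the standard basis of $\mathbb R^N$. Keep residuals $r_1,\dots,r_N$, initially $r_n=\lambda_n$, and a counter $m$, initially $m=1$. For $n=1,\dots,N$ in this order, repeat the following step until $r_n=0$. - If $r_n\ge a_m^2$: set $f_m=a_me_n$, replace $r_n$ by $r_n-a_m^2$, and replace $m$ by $m+1$. - Otherwise: if $2r_n=a_m^2+a_{m+1}^2$, set $f_m=\sqrt{r_n/2}\,(e_n+e_{n+1})$ and $f_{m+1}=\sqrt{r_n/2}\,(e_n-e_{n+1})$; if not, put $y=a_m^2+a_{m+1}^2-r_n$ and set $f_m=\sqrt{\frac{r_n(a_m^2-y)}{r_n-y}}\,e_n+\sqrt{\frac{y(r_n-a_m^2)}{r_n-y}}\,e_{n+1}$ and $f_{m+1}=\sqrt{\frac{r_n(r_n-a_m^2)}{r_n-y}}\,e_n-\sqrt{\frac{y(a_m^2-y)}{r_n-y}}\,e_{n+1}$. In either case then replace $r_{n+1}$ by $r_{n+1}-(a_m^2+a_{m+1}^2-r_n)$, $r_n$ by $0$, and $m$ by $m+2$. If after this the new $r_{n+1}$ is $0$, row $n+1$ is already finished and the algorithm moves on to the row after it. The output is $(f_m)_{m=1}^M\subseteq\mathbb R^N$. ''PNSTC can be used to construct''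 a frame with the given norms and eigenvalues means that, for some ordering of the two sequences, the algorithm can be carried out and outputs such a frame (vectors relabelled accordingly). *)

(* Defs.v *)
From HB Require Import structures.
From mathcomp Require Import all_boot all_order all_fingroup all_algebra.
From mathcomp Require Import reals.

Set Implicit Arguments.
Unset Strict Implicit.
Unset Printing Implicit Defensive.

Import Order.TTheory GRing.Theory Num.Theory.
Local Open Scope ring_scope.

(* All indices are 0-based: the mathematical a_1, ..., a_M are a 0, ...,      *)
(* a (M-1), so that a_(m_k + 2) is [ext a (m_k).+1].                          *)

(* Extension by 0, so that sequences can be indexed by expressions in nat.    *)
Definition ext (R : realType) (n : nat) (x : 'I_n -> R) (i : nat) : R :=
  oapp x 0 (insub i).

Definition synthesis (R : realType) (N M : nat) (f : 'I_M -> 'cV[R]_N) :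
  'M[R]_(N, M) := \matrix_(i < N, m < M) f m i 0.

Definition frame_operator (R : realType) (N M : nat) (f : 'I_M -> 'cV[R]_N) :
  'M[R]_N := synthesis f *m (synthesis f)^T.

(* Loewner order: Q - P is positive semidefinite. *)
Definition loewner_le (R : realType) (N : nat) (P Q : 'M[R]_N) : Prop :=
  forall x : 'cV[R]_N, 0 <= (x^T *m (Q - P) *m x) 0 0.

Definition is_frame (R : realType) (N M : nat) (f : 'I_M -> 'cV[R]_N) : Prop :=
  exists A B : R, [/\ 0 < A, 0 < B, loewner_le A%:M (frame_operator f)
                    & loewner_le (frame_operator f) B%:M].

(* The library norm on matrices is the sup norm. *)
Definition euclidean_norm (R : realType) (N : nat) (v : 'cV[R]_N) : R :=
  Num.sqrt (\sum_(i < N) v i 0 ^+ 2).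

(* Eigenvalues are counted with multiplicity. *)
Definition frame_eigenvalues (R : realType) (N M : nat)
    (f : 'I_M -> 'cV[R]_N) (lam : 'I_N -> R) : Prop :=
  char_poly (frame_operator f) = \prod_(n < N) ('X - (lam n)%:P).

(* Only mm 1, ..., mm N matter. *)
Definition spectral_tetris_ready (R : realType) (N M : nat)
    (a : 'I_M -> R) (lam : 'I_N -> R) : Prop :=
  \sum_(m < M) a m ^+ 2 = \sum_(n < N) lam n /\
  exists mm : nat -> nat,
    [/\ mm N = M,
        forall k, (0 < k < N)%N -> (mm k < mm k.+1)%N
      & forall k, (0 < k < N)%N ->
          let A j := \sum_(m < j) ext a m ^+ 2 in
          let L := \sum_(n < k) ext lam n in
          A (mm k) <= L < A (mm k).+1 /\
          (A (mm k) < L ->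
             (2 <= mm k.+1 - mm k)%N /\
             L - A (mm k) <= ext a (mm k).+1 ^+ 2)].

Definition basis_vec (R : realType) (N : nat) (n : nat) : 'cV[R]_N :=
  \col_(i < N) (i == n :> nat)%:R.

(* [pnstc_exec a n r m fs out]: the execution of the algorithm from row n,    *)
(* residuals r, counter m and already constructed vectors fs can be carried   *)
(* out to the end, and it outputs out. Being able to carry out a step means   *)
(* that the indices it uses are in range and that it only takes square roots  *)
(* of nonnegative numbers; in the last case the denominator r n - y is        *)
(* nonzero because 2 r n <> a_m^2 + a_(m+1)^2.                                *)
Inductive pnstc_exec (R : realType) (N M : nat) (a : 'I_M -> R) :
    nat -> (nat -> R) -> nat -> seq 'cV[R]_N -> seq 'cV[R]_N -> Prop :=
| exec_done r fs :
    pnstc_exec a N r M fs fs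
| exec_next_row n r m fs out :
    (n < N)%N -> r n = 0 ->
    pnstc_exec a n.+1 r m fs out ->
    pnstc_exec a n r m fs out
| exec_single n r m fs out :
    (n < N)%N -> r n != 0 -> (m < M)%N ->
    ext a m ^+ 2 <= r n ->
    pnstc_exec a n [eta r with n |-> r n - ext a m ^+ 2] m.+1
      (rcons fs (ext a m *: basis_vec R N n)) out ->
    pnstc_exec a n r m fs out
| exec_pair_eq n r m fs out :
    (n.+1 < N)%N -> r n != 0 -> (m.+1 < M)%N ->
    r n < ext a m ^+ 2 ->
    2 * r n = ext a m ^+ 2 + ext a m.+1 ^+ 2 ->
    0 <= r n / 2 ->
    let y := ext a m ^+ 2 + ext a m.+1 ^+ 2 - r n in
    let c := Num.sqrt (r n / 2) in
    pnstc_exec a n [eta r with n |-> 0, n.+1 |-> r n.+1 - y] m.+2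
      (fs ++ [:: c *: (basis_vec R N n + basis_vec R N n.+1);
                 c *: (basis_vec R N n - basis_vec R N n.+1)]) out ->
    pnstc_exec a n r m fs out
| exec_pair_neq n r m fs out :
    (n.+1 < N)%N -> r n != 0 -> (m.+1 < M)%N ->
    r n < ext a m ^+ 2 ->
    2 * r n != ext a m ^+ 2 + ext a m.+1 ^+ 2 ->
    let y := ext a m ^+ 2 + ext a m.+1 ^+ 2 - r n in
    let p := r n * (ext a m ^+ 2 - y) / (r n - y) in
    let q := y * (r n - ext a m ^+ 2) / (r n - y) in
    let s := r n * (r n - ext a m ^+ 2) / (r n - y) in
    let t := y * (ext a m ^+ 2 - y) / (r n - y) in
    [/\ 0 <= p, 0 <= q, 0 <= s & 0 <= t] ->
    pnstc_exec a n [eta r with n |-> 0, n.+1 |-> r n.+1 - y] m.+2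
      (fs ++ [:: Num.sqrt p *: basis_vec R N n
                   + Num.sqrt q *: basis_vec R N n.+1;
                 Num.sqrt s *: basis_vec R N n
                   - Num.sqrt t *: basis_vec R N n.+1]) out ->
    pnstc_exec a n r m fs out.

(* Readiness is a requirement on the parameters of the algorithm, and it does *)
(* not follow from the executability of the steps: for a^2 = (1, 1, 1, 1) and *)
(* lam = (1/2, 3/2, 1/2, 3/2) all the steps can be carried out, but no        *)
(* reordering of these sequences is ready.                                    *)
Definition pnstc (R : realType) (N M : nat) (a : 'I_M -> R) (lam : 'I_N -> R)
    (out : seq 'cV[R]_N) : Prop :=
  spectral_tetris_ready a lam /\
  pnstc_exec a 0 (ext lam) 0 [::] out.

(* The algorithm, run on reorderings of a and lam, yields f once its output   *)
(* vectors are relabelled to match the original order of a.                   *)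
Definition pnstc_constructs (R : realType) (N M : nat)
    (a : 'I_M -> R) (lam : 'I_N -> R) (f : 'I_M -> 'cV[R]_N) : Prop :=
  exists (s : {perm 'I_M}) (t : {perm 'I_N}) (out : seq 'cV[R]_N),
    pnstc (fun m => a (s m)) (fun n => lam (t n)) out /\
    forall m : 'I_M, f (s m) = nth 0 out m.

(* Main.v *)
(** Number the rows from 0. At row [k] the invariant is [A m + r = L k.+1] and
    [m <= m_(k+1)], where [A] and [L] are the partial sums of the squared norms
    and of the eigenvalues and [r] is the residual of the row. If
    [m < m_(k+1)], condition (i) gives [a_m^2 <= r]; if [m = m_(k+1)] and
    [r > 0], conditions (i) and (ii) give [r < a_m^2], [r <= a_(m+1)^2] and
    enough room in the next row for the two-by-two block. In that case
    [2 r < a_m^2 + a_(m+1)^2], so the branch [2 r = a_m^2 + a_(m+1)^2] of the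
    algorithm is never taken. The rows of the synthesis matrix stay orthogonal
    throughout, so the frame operator of the output is diagonal. *)
Require Import Defs.
From HB Require Import structures.
From mathcomp Require Import all_boot all_order all_fingroup all_algebra.
From mathcomp Require Import reals.
From mathcomp Require Import ring lra zify.

Set Implicit Arguments.
Unset Strict Implicit.
Unset Printing Implicit Defensive.

Import Order.TTheory GRing.Theory Num.Theory.
Local Open Scope ring_scope.

(** * Preliminaries: rank-one sums and vectors supported on two coordinates *)

(** This is the frame operator of the listed vectors, in a form where appending vectors to the list
    just adds terms. *)
Definition gram_sum (R : realType) (N : nat) (fs : seq 'cV[R]_N) : 'M[R]_N :=
  \sum_(f <- fs) f *m f^T.

Lemma extE (R : realType) (n : nat) (x : 'I_n -> R) (i : 'I_n) : ext x i = x i.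
Proof. by rewrite /ext valK. Qed.

Lemma ext_gt0 (R : realType) (n : nat) (x : 'I_n -> R) (i : nat) :
  (forall i, 0 < x i) -> (i < n)%N -> 0 < ext x i.
Proof. by move=> x_gt0 lt_in; rewrite -[i]/(val (Ordinal lt_in)) extE. Qed.

Lemma sum_sqr_mono (R : realType) (u : nat -> R) (m n : nat) :
  (m <= n)%N -> \sum_(i < m) u i ^+ 2 <= \sum_(i < n) u i ^+ 2.
Proof.
move=> /subnKC <-; elim: (n - m)%N => [|p IHp]; first by rewrite addn0.
by rewrite addnS big_ord_recr (le_trans IHp)// lerDl sqr_ge0.
Qed.

(** The only off-diagonal entries, at rows [n] and [k], are [x * y - z * w]; the hypothesis cancels
    them, which keeps the two rows of the synthesis matrix orthogonal. *)
Lemma outer_basis2 (R : realType) (N n k : nat) (x y z w : R) :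
  n != k -> x * y = z * w ->
  let e := basis_vec R N in
  let u := x *: e n + y *: e k in
  let v := z *: e n - w *: e k in
  u *m u^T + v *m v^T =
  \matrix_(i, j) ((i == j)%:R * ((x ^+ 2 + z ^+ 2) * (i == n :> nat)%:R
                               + (y ^+ 2 + w ^+ 2) * (i == k :> nat)%:R)).
Proof.
move=> nk xyzw /=; apply/matrixP=> i j.
rewrite !mxE !big_ord1 !mxE -(inj_eq val_inj) /=.
case: (eqVneq (i : nat) j) => [<-|ij].
  case: (eqVneq (i : nat) n) => [->|_]; first by rewrite (negbTE nk) /=; ring.
  by case: eqP => _ /=; ring.
case: (eqVneq (i : nat) n) => [ein|_].
  rewrite [in i == k :> nat]ein (negbTE nk) -ein eq_sym (negbTE ij) /=.
  by case: eqP => _ /=; nra.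
case: (eqVneq (i : nat) k) => [eik|_]; last by rewrite /=; ring.
rewrite -eik [j == i :> nat]eq_sym (negbTE ij) /=.
by case: eqP => _ /=; nra.
Qed.

Lemma sum_indicator (R : realType) (N n : nat) (c : R) : (n < N)%N ->
  \sum_(i < N) c * (i == n :> nat)%:R = c.
Proof.
move=> nN; rewrite (bigD1 (Ordinal nN)) //= eqxx mulr1 big1 ?addr0// => i.
by rewrite -(inj_eq val_inj) /= => /negbTE ->; rewrite mulr0.
Qed.

Lemma euclidean_norm_basis2 (R : realType) (N n k : nat) (x y : R) :
  n != k -> (n < N)%N -> (k < N)%N ->
  euclidean_norm (x *: basis_vec R N n + y *: basis_vec R N k) =
  Num.sqrt (x ^+ 2 + y ^+ 2).
Proof.
move=> nk nN kN; rewrite /euclidean_norm; congr Num.sqrt.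
rewrite -[X in _ = X + _](sum_indicator _ nN).
rewrite -[X in _ = _ + X](sum_indicator _ kN).
rewrite -big_split; apply: eq_bigr => i _; rewrite !mxE /=.
case: (eqVneq (i : nat) n) => [->|_]; first by rewrite (negbTE nk) /=; ring.
by case: eqP => _ /=; ring.
Qed.

Lemma euclidean_norm_basis (R : realType) (N n : nat) (x : R) : (n < N)%N ->
  euclidean_norm (x *: basis_vec R N n) = `|x|.
Proof.
move=> nN; rewrite -sqrtr_sqr /euclidean_norm; congr Num.sqrt.
rewrite -[RHS](sum_indicator _ nN); apply: eq_bigr => i _; rewrite !mxE.
by case: eqP => _ /=; ring.
Qed.

(** * The invariant of the constructed vectors *)

(** The third clause says that the rows built so far are orthogonal and that row [i] still lacks
    [r i] of its prescribed squared norm. With [r] zero and [m] equal to [M] this describes the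
    desired output. *)
Definition partial_output (R : realType) (N M : nat) (a : 'I_M -> R)
    (lam : 'I_N -> R) (r : nat -> R) (m : nat) (fs : seq 'cV[R]_N) : Prop :=
  [/\ size fs = m,
      forall i, (i < m)%N -> euclidean_norm (nth 0 fs i) = ext a i
    & gram_sum fs = \matrix_(i, j) ((i == j)%:R * (lam i - r i))].

Lemma partial_output_single (R : realType) (N M : nat) (a : 'I_M -> R)
    (lam : 'I_N -> R) (r : nat -> R) (m n : nat) (fs : seq 'cV[R]_N) :
  (n < N)%N -> 0 < ext a m ->
  partial_output a lam r m fs ->
  partial_output a lam [eta r with n |-> r n - ext a m ^+ 2] m.+1
    (rcons fs (ext a m *: basis_vec R N n)).
Proof.
move=> nN am [sz nrm gr]; split; first by rewrite size_rcons sz.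
  move=> i; rewrite ltnS nth_rcons sz => im.
  case: ltnP => [/nrm//|mi]; have -> : i = m by lia.
  by rewrite eqxx euclidean_norm_basis// gtr0_norm.
rewrite /gram_sum big_rcons /= -/(gram_sum fs) gr.
apply/matrixP=> i j; rewrite !mxE big_ord1 !mxE /= -(inj_eq val_inj) /=.
case: (eqVneq (i : nat) j) => [<-|ij].
  by case: (eqVneq (i : nat) n) => [->|_] /=; ring.
case: (eqVneq (i : nat) n) => [<-|_] /=; last by ring.
by rewrite eq_sym (negbTE ij) /=; ring.
Qed.

(** The block adds [p + s] to row [n] and [q + t] to row [n.+1], and [p * q = s * t] is the
    orthogonality of these rows. Only these relations between the radicands matter, so they stay
    abstract here. *)
Lemma partial_output_pair (R : realType) (N M : nat) (a : 'I_M -> R)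
    (lam : 'I_N -> R) (r : nat -> R) (m n : nat) (fs : seq 'cV[R]_N)
    (p q s t : R) :
  (n.+1 < N)%N -> 0 < ext a m -> 0 < ext a m.+1 ->
  [/\ 0 <= p, 0 <= q, 0 <= s & 0 <= t] ->
  p * q = s * t -> p + q = ext a m ^+ 2 -> s + t = ext a m.+1 ^+ 2 ->
  p + s = r n ->
  partial_output a lam r m fs ->
  partial_output a lam [eta r with n |-> 0, n.+1 |-> r n.+1 - (q + t)] m.+2
    (fs ++ [:: Num.sqrt p *: basis_vec R N n
                 + Num.sqrt q *: basis_vec R N n.+1;
               Num.sqrt s *: basis_vec R N n
                 - Num.sqrt t *: basis_vec R N n.+1]).
Proof.
move=> nN am am1 [p0 q0 s0 t0] pqst pq st ps [sz nrm gr].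
have nn : n != n.+1 by lia.
have nN' : (n < N)%N by lia.
split; first by rewrite size_cat sz addn2.
  move=> i im; rewrite nth_cat sz.
  case: ltnP => [/nrm//|mi]; have [->|->] : i = m \/ i = m.+1 by lia.
    rewrite subnn /= euclidean_norm_basis2// !sqr_sqrtr// pq sqrtr_sqr.
    by rewrite gtr0_norm.
  rewrite subSnn /= -scaleNr euclidean_norm_basis2// sqrrN !sqr_sqrtr// st.
  by rewrite sqrtr_sqr gtr0_norm.
rewrite /gram_sum big_cat /= -/(gram_sum fs) gr !big_cons big_nil addr0.
rewrite outer_basis2// -?sqrtrM ?pqst ?sqrtrM// !sqr_sqrtr//.
apply/matrixP=> i j; rewrite !mxE /=.
case: eqP => _ /=; last by ring.
case: (eqVneq (i : nat) n) => [->|_] /=; first by rewrite (negbTE nn) /=; lra.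
by case: eqP => [->|_] /=; ring.
Qed.

(** From [r < b] and [r <= c] one gets [y >= b > r > 0]. Hence the denominator [r - y] is negative
    and all four numerators are nonpositive. *)
Lemma pair_coefficients (R : realType) (r b c : R) :
  0 < r -> r < b -> r <= c ->
  let y := b + c - r in
  let p := r * (b - y) / (r - y) in
  let q := y * (r - b) / (r - y) in
  let s := r * (r - b) / (r - y) in
  let t := y * (b - y) / (r - y) in
  [/\ 0 <= p, 0 <= q, 0 <= s & 0 <= t] /\
  [/\ p * q = s * t, p + q = b, s + t = c, p + s = r & q + t = y].
Proof.
move=> r0 rb rc /=.
have ry : r - (b + c - r) < 0 by lra.
have ry0 : r - (b + c - r) != 0 by rewrite lt_eqF.
by split; split; try field; rewrite // ler_ndivlMr// mul0r; nra.
Qed.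

(** * Carrying out the algorithm on ready sequences *)

(** The state is arbitrary so that induction applies: rows before [n] are exhausted, rows after [n]
    are untouched, and [r n + A m = L n.+1] records the budget of row [n]. *)
Lemma pnstc_exec_complete (R : realType) (N M : nat) (a : 'I_M -> R)
    (lam : 'I_N -> R) (mm : nat -> nat) (a_gt0 : forall m, 0 < a m)
    (lam_gt0 : forall n, 0 < lam n)
    (A := fun j => \sum_(m < j) ext a m ^+ 2)
    (L := fun k => \sum_(n < k) ext lam n)
    (AMLN : A M = L N) (mmN : mm N = M)
    (mm_lt : forall k, (0 < k < N)%N -> (mm k < mm k.+1)%N)
    (ready : forall k, (0 < k < N)%N ->
       A (mm k) <= L k < A (mm k).+1 /\
       (A (mm k) < L k -> (2 <= mm k.+1 - mm k)%N /\
          L k - A (mm k) <= ext a (mm k).+1 ^+ 2))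
    (n m : nat) (r : nat -> R) (fs : seq 'cV[R]_N) :
  (n < N)%N -> (m <= mm n.+1)%N -> 0 <= r n -> r n + A m = L n.+1 ->
  (forall j, (j < n)%N -> r j = 0) ->
  (forall j, (n < j < N)%N -> r j = ext lam j) ->
  partial_output a lam r m fs ->
  exists out, pnstc_exec a n r m fs out /\
              partial_output a lam (fun=> 0) M out.
Proof.
have A_mono i j : (i <= j)%N -> A i <= A j by exact: sum_sqr_mono.
have A_S j : A j.+1 = A j + ext a j ^+ 2 by rewrite /A big_ord_recr.
have L_S j : L j.+1 = L j + ext lam j by rewrite /L big_ord_recr.
(* The lower half of condition (i) extends to [k = N], where it is the equality of the total
   sums. *)
have AL k : (0 < k <= N)%N -> A (mm k) <= L k.
  move=> /andP[k0]; rewrite leq_eqVlt => /orP[/eqP->|kN].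
    by rewrite mmN AMLN.
  by have [/andP[]] := ready k (introT andP (conj k0 kN)).
have mmM k : (0 < k <= N)%N -> (mm k <= M)%N.
  move=> /andP[k0 kN]; rewrite -mmN.
  elim: N kN mm_lt {AMLN mmN ready AL lam lam_gt0 L L_S fs} =>
    [|N' IH]; first lia.
  rewrite leq_eqVlt => /orP[/eqP->//|kN] lt.
  apply: leq_trans (IH _ _) (ltnW _) => //; last by apply: lt; lia.
  by move=> j jN; apply: lt; lia.
(* Every step either consumes a vector or finishes a row, so this measure decreases. *)
have [d] := ubnP ((M - m) + (N - n))%N.
elim: d => // d IHd in n m r fs * => le_d nN m_le r0 rA rlt rgt out_m.
have m_M : (m <= M)%N by apply: leq_trans m_le (mmM _ _).
(* Leaving an exhausted row is common to the case of a zero residual and to the case of a pair. A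
   pair changes [r n.+1], so its new state satisfies the invariant only from row [n.+1] on. *)
have next_row m' r' fs' : (m <= m')%N -> r' n = 0 ->
    (n.+1 = N -> m' = M) ->
    ((n.+1 < N)%N ->
       [/\ (m' <= mm n.+2)%N, 0 <= r' n.+1 & r' n.+1 + A m' = L n.+2]) ->
    (forall j, (j < n)%N -> r' j = 0) ->
    (forall j, (n.+1 < j < N)%N -> r' j = ext lam j) ->
    partial_output a lam r' m' fs' ->
    exists out, pnstc_exec a n r' m' fs' out /\
                partial_output a lam (fun=> 0) M out.
  move=> mm' rn0 last_row inner r'lt r'gt out_m'.
  have r'lt1 j : (j < n.+1)%N -> r' j = 0.
    by rewrite ltnS leq_eqVlt => /orP[/eqP->//|/r'lt].
  have [nN1|nN1] := ltnP n.+1 N.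
    have [m'_le r'0 r'A] := inner nN1.
    have [|out [ex out_ok]] := IHd n.+1 m' r' fs' _ nN1 m'_le r'0 r'A r'lt1
      r'gt out_m'; first by lia.
    by exists out; split => //; apply: exec_next_row.
  have En : n.+1 = N by lia.
  exists fs'; split.
    by apply: exec_next_row; rewrite // En (last_row En); apply: exec_done.
  case: out_m'; rewrite (last_row En) => sz nrm gr; split => //.
  by rewrite gr; apply/matrixP => i j; rewrite !mxE r'lt1// En.
have [rn0|rn0] := eqVneq (r n) 0.
  apply: next_row => //.
  (* A vector left over after the last row would give [A m < A M], although both equal [L N]. *)
  - move=> En; apply/eqP; rewrite eqn_leq m_M leqNgt; apply/negP => mM.
    have := A_mono m.+1 M mM; rewrite A_S AMLN.
    have : 0 < ext a m ^+ 2 by rewrite exprn_gt0// ext_gt0.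
    by move: rA; rewrite rn0 En; lra.
  - move=> nN1; have -> : r n.+1 = ext lam n.+1 by apply: rgt; lia.
    split; first by have := mm_lt n.+1; lia.
      by rewrite ltW// ext_gt0.
    by rewrite L_S -rA rn0; ring.
  - by move=> j jn; apply: rgt; lia.
have rn_gt0 : 0 < r n by rewrite lt_neqAle eq_sym rn0.
have single : (m < mm n.+1)%N -> exists out, pnstc_exec a n r m fs out /\
                partial_output a lam (fun=> 0) M out.
  move=> m_lt; have mM : (m < M)%N by apply: leq_trans m_lt (mmM _ _).
  (* Here [A m.+1 <= A (mm n.+1) <= L n.+1 = r n + A m]. *)
  have ar : ext a m ^+ 2 <= r n.
    have := A_mono _ _ m_lt; have := AL n.+1 nN; rewrite A_S; lra.
  set r' := [eta r with n |-> r n - ext a m ^+ 2].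
  have r'n : r' n = r n - ext a m ^+ 2 by rewrite /r' /= eqxx.
  have r'j j : j != n -> r' j = r j by rewrite /r' /= => /negbTE->.
  have [||||||out [ex out_ok]] := IHd n m.+1 r'
    (rcons fs (ext a m *: basis_vec R N n)) _ nN m_lt.
  - by lia.
  - by rewrite r'n subr_ge0.
  - by rewrite r'n A_S -rA; ring.
  - by move=> j jn; rewrite r'j ?rlt//; lia.
  - by move=> j jn; rewrite r'j ?rgt//; lia.
  - by apply: partial_output_single => //; apply: ext_gt0.
  by exists out; split => //; apply: exec_single.
have [/single//|m_ge] := ltnP m (mm n.+1).
have {m_le m_ge} Em : m = mm n.+1 by apply/eqP; rewrite eqn_leq m_le.
(* In the last row [m] would be [M], and equality of the total sums would make the residual zero. *)
have [nN1|nN1] := ltnP n.+1 N; last first.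
  have En : n.+1 = N by lia.
  by move: rA; rewrite Em En mmN AMLN => ?; exfalso; lra.
(* Now [r n] is exactly [L n.+1 - A (mm n.+1)], the quantity bounded in (i) and (ii). *)
have [/andP[_ ltLA]] := ready n.+1 nN1; rewrite -Em in ltLA *.
case; first by lra.
move=> m2 La.
have mM1 : (m.+1 < M)%N by have := mmM n.+2 nN1; lia.
have r_lt : r n < ext a m ^+ 2 by move: ltLA; rewrite A_S; lra.
have r_le : r n <= ext a m.+1 ^+ 2 by lra.
have [pos [pqst pq st ps qt]] := pair_coefficients rn_gt0 r_lt r_le.
set p := _ * _ / _ in pos pqst pq ps.
set q := _ * _ / _ in pos pqst pq qt.
set s := _ * _ / _ in pos pqst st ps.
set t := _ * _ / _ in pos pqst st qt.
set r' := [eta r with n |-> 0, n.+1 |-> r n.+1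
                                  - (ext a m ^+ 2 + ext a m.+1 ^+ 2 - r n)].
have r'n : r' n = 0 by rewrite /r' /= eqxx.
have r'n1 : r' n.+1 = ext lam n.+1 - (ext a m ^+ 2 + ext a m.+1 ^+ 2 - r n).
  by rewrite /r' /= eqxx (gtn_eqF (ltnSn n)) rgt// ltnSn.
have r'j j : j != n -> j != n.+1 -> r' j = r j.
  by rewrite /r' /= => /negbTE-> /negbTE->.
have am2 : ext a m ^+ 2 + ext a m.+1 ^+ 2 - r n + L n.+1 = A m.+2.
  by have := A_S m; have := A_S m.+1; lra.
have r'L : r' n.+1 + A m.+2 = L n.+2 by have := L_S n.+1; lra.
have [|||||||out [ex out_ok]] := next_row m.+2 r'
  (fs ++ [:: Num.sqrt p *: basis_vec R N n + Num.sqrt q *: basis_vec R N n.+1;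
             Num.sqrt s *: basis_vec R N n - Num.sqrt t *: basis_vec R N n.+1]).
- by lia.
- exact: r'n.
- by lia.
(* The new residual is [L n.+2 - A m.+2]; it is nonnegative because (ii) puts [m.+2] at or below
   [mm n.+2]. *)
- move=> _; split => //; first by lia.
  have m2_le : (m.+2 <= mm n.+2)%N by lia.
  by have := A_mono _ _ m2_le; have := AL n.+2 nN1; lra.
- by move=> j jn; rewrite r'j ?rlt//; lia.
- by move=> j jn; rewrite r'j ?rgt//; lia.
- rewrite /r' -qt; apply: partial_output_pair => //; apply: ext_gt0 => //.
  by lia.
exists out; split => //; apply: exec_pair_neq => //.
by rewrite lt_eqF//; lra.
Qed.

Lemma ready_output (R : realType) (N M : nat) (a : 'I_M -> R)
    (lam : 'I_N -> R) :
  (forall m, 0 < a m) -> (forall n, 0 < lam n) ->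
  spectral_tetris_ready a lam ->
  exists out, pnstc a lam out /\ partial_output a lam (fun=> 0) M out.
Proof.
move=> a_gt0 lam_gt0 rdy; have [sum_eq [mm [mmN mm_lt ready]]] := rdy.
have AMLN : \sum_(m < M) ext a m ^+ 2 = \sum_(n < N) ext lam n.
  under eq_bigr do rewrite extE; rewrite sum_eq.
  by apply: eq_bigr => i _; rewrite extE.
have out0 : partial_output a lam (ext lam) 0 [::].
  split => //; rewrite /gram_sum big_nil; apply/matrixP => i j.
  by rewrite !mxE extE subrr mulr0.
(* With no rows, positivity of the norms forces [M = 0] and the run stops at once. *)
have [N0|N_gt0] := posnP N.
  have M0 : M = 0%N.
    apply/eqP; rewrite -leqn0 leqNgt; apply/negP => M_gt0.
    have := sum_sqr_mono (ext a) M_gt0; rewrite AMLN big_ord1.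
    have : 0 < ext a 0 ^+ 2 by rewrite exprn_gt0// ext_gt0.
    by rewrite [X in _ <= X]big1; [lra | case=> i iN; exfalso; lia].
  clear mmN ready mm_lt; subst N M; exists [::].
  split; first by split => //; apply: exec_done.
  case: out0 => sz nrm gr; split => //.
  by apply/matrixP => -[].
have [||||||out [ex out_ok]] := @pnstc_exec_complete R N M a lam mm a_gt0
  lam_gt0 AMLN mmN mm_lt ready 0 0 (ext lam) [::] N_gt0 => //.
- by rewrite ltW// ext_gt0.
- by rewrite big_ord0 addr0 big_ord1.
- by exists out.
Qed.

(** * Frame bounds, relabelling and the equivalence *)

Lemma diag_frame (R : realType) (N M : nat) (f : 'I_M -> 'cV[R]_N)
    (d : 'rV[R]_N) :
  (forall i, 0 < d 0 i) -> frame_operator f = diag_mx d -> is_frame f.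
Proof.
move=> d_gt0 fE.
have quad (e : 'rV[R]_N) (x : 'cV[R]_N) : (forall i, 0 <= e 0 i) ->
    0 <= (x^T *m diag_mx e *m x) 0 0.
  move=> e_ge0; rewrite mul_mx_diag mxE sumr_ge0// => i _; rewrite !mxE.
  by rewrite mulrAC mulr_ge0// -expr2 sqr_ge0.
(* These lie below and above every diagonal entry; the summand 1 keeps both positive even when
   [N = 0]. *)
pose A := (1 + \sum_i (d 0 i)^-1)^-1; pose B := 1 + \sum_i d 0 i.
have le_sum (u : 'I_N -> R) i : (forall j, 0 < u j) -> u i <= 1 + \sum_j u j.
  move=> u_gt0; rewrite (bigD1 i)//= addrCA lerDl addr_ge0// sumr_ge0// => j _.
  exact: ltW.
have A_gt0 : 0 < A.
  rewrite invr_gt0 ltr_pwDl// sumr_ge0// => i _.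
  by rewrite invr_ge0 ltW.
exists A, B; split => //.
- by rewrite ltr_pwDl// sumr_ge0// => i _; rewrite ltW.
- move=> x; rewrite fE -diag_const_mx -linearB; apply: quad => i; rewrite !mxE.
  rewrite subr_ge0 -[leRHS]invrK lef_pV2 ?posrE ?invr_gt0//; last first.
    by rewrite -invr_gt0.
  by apply: (le_sum (fun i => (d 0 i)^-1)) => j; rewrite invr_gt0.
- move=> x; rewrite fE -diag_const_mx -linearB; apply: quad => i; rewrite !mxE.
  by rewrite subr_ge0 (le_sum (fun i => d 0 i)).
Qed.

(** Relabelling the vectors only permutes the rank-one terms. *)
Lemma frame_operator_gram (R : realType) (N M : nat) (s : {perm 'I_M})
    (f : 'I_M -> 'cV[R]_N) (out : seq 'cV[R]_N) :
  size out = M -> (forall m, f (s m) = nth 0 out m) ->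
  frame_operator f = gram_sum out.
Proof.
move=> sz fE; apply/matrixP => i j; rewrite /gram_sum mxE summxE.
rewrite (big_nth 0) sz big_mkord (reindex_inj (@perm_inj _ s)).
by apply: eq_bigr => m _; rewrite !mxE big_ord1 !mxE fE.
Qed.

Theorem theorem3p6 (R : realType) (N M : nat)
    (a : 'I_M -> R) (lam : 'I_N -> R)
    (a_gt0 : forall m, 0 < a m) (lam_gt0 : forall n, 0 < lam n) :
  (exists f : 'I_M -> 'cV[R]_N,
     [/\ pnstc_constructs a lam f, is_frame f,
         forall m, euclidean_norm (f m) = a m
       & frame_eigenvalues f lam])
  <->
  (exists (s : {perm 'I_M}) (t : {perm 'I_N}),
     spectral_tetris_ready (fun m => a (s m)) (fun n => lam (t n))).
Proof.
(* Readiness of the reordered parameters is a component of [pnstc], so it is read off from the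
   run. *)
split=> [[f [[s [t [out [[rdy _] _]]]] _ _ _]]|[s [t rdy]]].
  by exists s, t.
have [out [out_pnstc [sz nrm gr]]] :=
  ready_output (fun m => a_gt0 (s m)) (fun n => lam_gt0 (t n)) rdy.
(* The inverse permutation undoes the reordering: [f (s m)] is the output vector number [m], whose
   norm is [a (s m)]. *)
pose f m : 'cV[R]_N := nth 0 out ((s^-1)%g m).
have fs m : f (s m) = nth 0 out m by rewrite /f permK.
have fE : frame_operator f = diag_mx (\row_n lam (t n)).
  rewrite (frame_operator_gram sz fs) gr; apply/matrixP => i j.
  by rewrite !mxE subr0 mulr_natl.
exists f; split.
- by exists s, t, out.
- by apply: (diag_frame _ fE) => n; rewrite mxE.
- move=> m; rewrite -[m](permKV s) fs nrm//.
  exact: (extE (fun m => a (s m))).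
(* The diagonal carries the eigenvalues in the order given by [t]; reindexing the product by [t]
   restores the original order. *)
- rewrite /frame_eigenvalues fE char_poly_trig ?diag_mx_is_trig//.
  rewrite [RHS](reindex_inj (@perm_inj _ t)).
  by apply: eq_bigr => n _; rewrite !mxE eqxx.
Qed.
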